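(* Let $\alpha,\beta\in\mathbb{R}$ with $\alpha\neq 0$, and let $G_1$ be the connected, simply connected three-dimensional Lie group with left-invariant Lorentzian metric $g$ whose Lie algebra has a pseudo-orthonormal basis $\{\widetilde e_1,\widetilde e_2,\widetilde e_3\}$, with $\widetilde e_3$ timelike, satisfying $$[\widetilde e_1,\widetilde e_2]=\alpha\widetilde e_1-\beta\widetilde e_3,\quad [\widetilde e_1,\widetilde e_3]=-\alpha\widetilde e_1-\beta\widetilde e_2,\quad [\widetilde e_2,\widetilde e_3]=\beta\widetilde e_1+\alpha\widetilde e_2+\alpha\widetilde e_3.$$ Then the symmetrized Ricci tensor $\widetilde\rho^c$ of the canonical connection $\nabla^c$ is not a Codazzi tensor on $(G_1,\nabla^c)$.
   Context: Basis vectors are identified with left-invariant vector fields on the group $G$; $g(\widetilde e_1,\widetilde e_1)=g(\widetilde e_2,\widetilde e_2)=1$, $g(\widetilde e_3,\widetilde e_3)=-1$, and $g(\widetilde e_i,\widetilde e_j)=0$ for $i\ne j$. Let $\nabla^L$ be the Levi-Civita connection of $g$ and $J$ the product structure on $G$ (a $(1,1)$ tensor field) with $J\widetilde e_1=\widetilde e_1$, $J\widetilde e_2=\widetilde e_2$, $J\widetilde e_3=-\widetilde e_3$. The canonical connection is $\nabla^c_XY=\nabla^L_XY-\tfrac12(\nabla^L_XJ)JY$, where $(\nabla^L_XJ)Y=\nabla^L_X(JY)-J\nabla^L_XY$. Curvature: $R^c(X,Y)Z=\nabla^c_X\nabla^c_YZ-\nabla^c_Y\nabla^c_XZ-\nabla^c_{[X,Y]}Z$.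 Ricci tensor: $\rho^c(X,Y)=-g(R^c(X,\widetilde e_1)Y,\widetilde e_1)-g(R^c(X,\widetilde e_2)Y,\widetilde e_2)+g(R^c(X,\widetilde e_3)Y,\widetilde e_3)$. Symmetrized Ricci tensor: $\widetilde\rho^c(X,Y)=\tfrac12(\rho^c(X,Y)+\rho^c(Y,X))$. For a linear connection $\nabla$ and a $(0,2)$ tensor field $\omega$: $(\nabla_X\omega)(Y,Z)=X[\omega(Y,Z)]-\omega(\nabla_XY,Z)-\omega(Y,\nabla_XZ)$. The tensor $\omega$ is called a Codazzi tensor on $(G,\nabla)$ if $(\nabla_X\omega)(Y,Z)-(\nabla_Y\omega)(X,Z)=0$ for all vector fields $X,Y,Z$. *)

(* Defs.v *)
From HB Require Import structures.
From mathcomp Require Import all_boot all_order all_algebra.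
From mathcomp Require Import all_classical all_reals all_analysis.
From mathcomp Require Import ring.

Set Implicit Arguments.
Unset Strict Implicit.
Unset Printing Implicit Defensive.

Import Order.TTheory GRing.Theory Num.Theory.
Import numFieldNormedType.Exports.

Local Open Scope classical_set_scope.
Local Open Scope ring_scope.

Section Smooth.
Variables (R : realType) (V W : normedModType R).

(* f is C^k on U, meant for an open U of a finite-dimensional V: the derivative
   of f is recorded through its values 'D_v f in every direction v. *)
Fixpoint Ck (k : nat) (U : set V) (f : V -> W) : Prop :=
  if k is k'.+1 then
    (forall x, U x -> differentiable f x) /\ (forall v, Ck k' U ('D_v f))
  else forall x, U x -> {for x, continuous f}.

Definition smooth_on (U : set V) (f : V -> W) : Prop := forall k, Ck k U f.

Lemma CkW k U f : Ck k.+1 U f -> Ck k U f.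
Proof.
elim: k f => [|k IHk] f [df Df].
  by move=> x /df/differentiable_continuous.
by split=> // v; apply: IHk.
Qed.

Lemma near_eq_differentiable (f h : V -> W) (x : V) :
  {near x, f =1 h} -> differentiable f x -> differentiable h x.
Proof.
move=> fh df; have fhx := nbhs_singleton fh.
have cf := diff_continuous df.
have Eh : h \o shift x = cst (h x) + 'd f x +o_ (0 : V) id.
  have /diff_locallyP[_ /eqaddoP Ef] := df; apply/eqaddoP => e e0.
  near=> y; rewrite !fctE /= -fhx.
  have <- : f (y + x) = h (y + x).
    near: y; move: fh; rewrite (near_shift 0) subr0 /=; exact.
  by near: y; exact: Ef.
by apply/diff_locallyP; rewrite (diff_unique cf Eh).
Unshelve. all: by end_near. Qed.

Lemma eq_Ck k U f h : open U -> (forall x, U x -> f x = h x) ->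
  Ck k U f -> Ck k U h.
Proof.
move=> oU; elim: k f h => [|k IHk] f h fh.
  move=> cf x Ux; have := cf x Ux; rewrite /prop_for /continuous_at -(fh _ Ux).
  move=> cfx; apply: cvg_trans cfx; apply: near_eq_cvg.
  by near=> y; rewrite fh//; near: y; exact: open_nbhs_nbhs.
have nfh x : U x -> {near x, f =1 h}.
  by move=> Ux; near=> y; rewrite fh//; near: y; exact: open_nbhs_nbhs.
move=> [df Df]; split=> [x Ux|v].
  exact: near_eq_differentiable (nfh x Ux) (df x Ux).
by apply: IHk (Df v) => x Ux; apply: near_eq_derive; exact: nfh.
Unshelve. all: by end_near. Qed.

Lemma Ck_cst k U (a : W) : open U -> Ck k U (cst a).
Proof.
move=> oU; elim: k a => [|k IHk] a /=.
  by move=> x _; exact: cst_continuous.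
split=> [x _|v]; first exact: differentiable_cst.
by apply: eq_Ck (IHk 0) => // x _; rewrite derive_cst.
Qed.

Lemma CkB k U f h : open U -> Ck k U f -> Ck k U h -> Ck k U (f - h).
Proof.
move=> oU; elim: k f h => [|k IHk] f h /=.
  by move=> cf ch x Ux; apply: continuousB; [exact: cf|exact: ch].
move=> [df Df] [dh Dh]; split=> [x Ux|v].
  by apply: differentiableB; [exact: df|exact: dh].
apply: eq_Ck (IHk _ _ (Df v) (Dh v)) => // x Ux.
by rewrite deriveB//; apply: diff_derivable; [exact: df|exact: dh].
Qed.
End Smooth.

Lemma CkM (R : realType) (V : normedModType R) k (U : set V) (f h : V -> R) :
  open U -> Ck k U f -> Ck k U h -> Ck k U (f * h).
Proof.
move=> oU; elim: k f h => [|k IHk] f h.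
  by move=> cf ch x Ux; apply: continuousM; [exact: cf|exact: ch].
move=> Cf Ch; have [df Df] := Cf; have [dh Dh] := Ch; split=> [x Ux|v].
  by apply: differentiableM; [exact: df|exact: dh].
have H1 := IHk _ _ (CkW Cf) (Dh v).
have H2 := IHk _ _ (CkW Ch) (Df v).
have := CkB oU H1 (CkB oU (Ck_cst k _ oU) H2).
move=> /(_ 0); apply: eq_Ck => // x Ux.
rewrite deriveM; last 2 first.
- exact: diff_derivable (df _ Ux).
- exact: diff_derivable (dh _ Ux).
by rewrite !fctE sub0r opprK.
Qed.

Section SmoothCalculus.
Variables (R : realType).

Lemma CkD (V W : normedModType R) k (U : set V) (f h : V -> W) :
  open U -> Ck k U f -> Ck k U h -> Ck k U (f + h).
Proof.
move=> oU Cf Ch; have := CkB oU Cf (CkB oU (Ck_cst k (0 : W) oU) Ch).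
by apply: eq_Ck => // x _; rewrite !fctE sub0r opprK.
Qed.

Lemma Ck_sum (V W : normedModType R) (m : nat) k (U : set V)
    (f : 'I_m -> V -> W) :
  open U -> (forall i, Ck k U (f i)) -> Ck k U (\sum_i f i).
Proof.
move=> oU Cf; elim/big_ind: _ => // [|a b]; first exact: (Ck_cst _ _ oU).
exact: CkD.
Qed.

Lemma Ck_local (V W : normedModType R) k (U : set V) (f : V -> W) :
  (forall x, U x -> exists A, [/\ open A, A x & Ck k A f]) -> Ck k U f.
Proof.
elim: k f => [|k IHk] f loc.
  by move=> x /loc[A [_ Ax /(_ x Ax)]].
split=> [x Ux|v]; first by have [A [_ Ax [df _]]] := loc _ Ux; exact: df.
apply: IHk => x Ux; have [A [oA Ax [_ Df]]] := loc _ Ux.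
by exists A; split=> //; exact: Df.
Qed.

Lemma Ck_coord (V : normedModType R) m k (U : set V) (f : V -> 'rV[R]_m)
  (j : 'I_m) : open U -> Ck k U f -> Ck k U (fun x => f x ord0 j).
Proof.
move=> oU; elim: k f => [|k IHk] f /=.
  move=> cf x Ux; apply: (@continuous_comp _ _ _ f (fun u => u ord0 j)).
    exact: cf.
  exact: coord_continuous.
move=> [df Df]; split=> [x Ux|v].
  apply: (@differentiable_comp _ _ _ _ f (fun u => u ord0 j)); first exact: df.
  exact: differentiable_coord.
apply: eq_Ck (IHk _ (Df v)) => // x Ux.
rewrite [RHS]deriveE; last first.
  apply: (@differentiable_comp _ _ _ _ f (fun u => u ord0 j)); first exact: df.
  exact: differentiable_coord.
rewrite (@diff_comp _ _ _ _ f (fun u => u ord0 j)); last 2 first.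
- exact: df.
- exact: differentiable_coord.
rewrite /= deriveE; last exact: df.
rewrite -/(('d f x v) ord0 j).
have lc : linear (fun u : 'rV[R]_m => u ord0 j : R^o).
  by move=> a u w; rewrite !mxE.
pose L : {linear 'rV[R]_m -> R^o} :=
  HB.pack (fun u : 'rV[R]_m => u ord0 j : R^o)
    (GRing.isLinear.Build _ _ _ _ _ lc).
have := @diff_lin _ _ _ L (f x).
by move=> -> //; exact: coord_continuous.
Qed.

Lemma Ck_comp (V : normedModType R) m k (U : set V) (A : set 'rV[R]_m)
    (h : V -> 'rV[R]_m) (f : 'rV[R]_m -> R) :
  open U -> (forall x, U x -> A (h x)) ->
  Ck k U h -> Ck k A f -> Ck k U (f \o h).
Proof.
move=> oU hA; elim: k f => [|k IHk] f.
  by move=> ch cf x Ux; apply: continuous_comp; [exact: ch|exact/cf/hA].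
move=> Ch Cf; have [dh Dh] := Ch; have [df Df] := Cf; split=> [x Ux|v].
  by apply: differentiable_comp; [exact: dh|exact/df/hA].
have := Ck_sum oU (fun j => CkM oU (Ck_coord j oU (Dh v))
  (IHk _ (CkW Ch) (Df (delta_mx ord0 j)))).
apply: eq_Ck => // x Ux.
have dhx := dh _ Ux; have dfx := df _ (hA _ Ux).
rewrite fct_sumE [RHS]deriveE; last exact: differentiable_comp.
rewrite diff_comp //= -(deriveE v dhx).
rewrite [in RHS](row_sum_delta ('D_v h x)) linear_sum.
apply: eq_bigr => j _; rewrite !fctE /= linearZ /=.
by rewrite -deriveE.
Qed.

Lemma open_slice (V1 V2 : normedModType R) (U : set (V1 * V2)) u :
  open U -> open [set y | U (u, y)].
Proof.
move=> oU; apply: (@open_comp _ _ (fun y => (u, y))) => // y _.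
by apply: cvg_pair; [exact: cvg_cst|exact: cvg_id].
Qed.

Lemma Ck_slice (V1 V2 W : normedModType R) k (U : set (V1 * V2)) u
    (h : V1 * V2 -> W) :
  open U -> Ck k U h -> Ck k [set y | U (u, y)] (fun y => h (u, y)).
Proof.
move=> oU.
have dpr (y : V2) : is_diff y (fun y => (u, y)) (fun w => (0, w) : V1 * V2).
  exact: is_diff_pair.
have oS := open_slice u oU.
elim: k h => [|k IHk] h /=.
  move=> ch y Uy; apply: (@continuous_comp _ _ _ (fun y => (u, y)) h);
    last exact: ch.
  exact: differentiable_continuous (@ex_diff _ _ _ _ _ _ _ (dpr y)).
move=> [dh Dh]; have dhs y : U (u, y) -> differentiable (fun y => h (u, y)) y.
  move=> Uy; apply: (@differentiable_comp _ _ _ _ (fun y => (u, y)) h) => //.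
  exact: dh.
split=> [y Uy|v]; first exact: dhs.
have E y : U (u, y) -> 'D_(0, v) h (u, y) = 'D_v (fun y => h (u, y)) y.
  move=> Uy; rewrite [RHS]deriveE; last exact: dhs.
  rewrite (@diff_comp _ _ _ _ (fun y => (u, y)) h) //; last exact: dh.
  by rewrite deriveE /= ?diff_val //; exact: dh.
exact: eq_Ck E (IHk _ (Dh (0, v))).
Qed.
End SmoothCalculus.

(* Only the restrictions of the two maps to the two open sets matter. *)
Record chart (R : realType) (n : nat) (T : topologicalType) := Chart {
  cdom : set T;
  ccod : set 'rV[R]_n;
  cmap : T -> 'rV[R]_n;
  cinv : 'rV[R]_n -> T;
  cdom_open : open cdom;
  ccod_open : open ccod;
  cmap_sub : forall x, cdom x -> ccod (cmap x);
  cinv_sub : forall u, ccod u -> cdom (cinv u);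
  cmapK : forall x, cdom x -> cinv (cmap x) = x;
  cinvK : forall u, ccod u -> cmap (cinv u) = u;
  cmap_cont : forall x, cdom x -> {for x, continuous cmap};
  cinv_cont : forall u, ccod u -> {for u, continuous cinv}
}.

HB.mixin Record isManifold (R : realType) (n : nat) T of Topological T := {
  atlas : set (chart R n T);
  manifold_hausdorff : hausdorff_space T;
  manifold_second_countable : @second_countable T;
  atlas_cover : forall x : T, exists2 c, atlas c & cdom c x;
  atlas_compatible : forall c d, atlas c -> atlas d ->
    smooth_on [set u | ccod c u /\ cdom d (cinv c u)] (cmap d \o cinv c)
}.

#[short(type="manifoldType")]
HB.structure Definition Manifold (R : realType) (n : nat) :=
  {T of isManifold R n T & Topological T}.

HB.mixin Record isLieGroup (R : realType) (n : nat) G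
    of Manifold R n G & Group G := {
  mulg_continuous : continuous (fun p : G * G => (p.1 * p.2)%g);
  invg_continuous : continuous (fun x : G => x^-1%g);
  mulg_smooth : forall c1 c2 d : chart R n G, atlas c1 -> atlas c2 -> atlas d ->
    smooth_on
      [set p | [/\ ccod c1 p.1, ccod c2 p.2 &
                 cdom d (cinv c1 p.1 * cinv c2 p.2)%g]]
      (fun p : 'rV[R]_n * 'rV[R]_n => cmap d (cinv c1 p.1 * cinv c2 p.2)%g);
  invg_smooth : forall c d : chart R n G, atlas c -> atlas d ->
    smooth_on [set u | ccod c u /\ cdom d (cinv c u)^-1%g]
      (fun u => cmap d (cinv c u)^-1%g)
}.

#[short(type="lieGroupType")]
HB.structure Definition LieGroup (R : realType) (n : nat) :=
  {G of isLieGroup R n G & Manifold R n G & Group G}.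

(* Every loop is homotopic to a constant loop relative to its base point;
   path-connectedness is not part of this definition. *)
Definition simply_connected (R : realType) (T : topologicalType) : Prop :=
  forall gamma : R -> T, {within `[0, 1], continuous gamma} ->
    gamma 0 = gamma 1 ->
  exists H : R * R -> T,
    [/\ {within `[0, 1] `*` `[0, 1], continuous H},
        (forall t, t \in `[0, 1] -> H (0, t) = gamma t),
        (forall t, t \in `[0, 1] -> H (1, t) = gamma 0) &
        (forall s, s \in `[0, 1] -> H (s, 0) = gamma 0 /\ H (s, 1) = gamma 0)].

Section SmoothFunctions.
Variables (R : realType) (n : nat) (M : manifoldType R n).

Definition smooth_fun : {pred M -> R} :=
  fun f => `[< forall c : chart R n M, atlas c ->
                 smooth_on (ccod c) (f \o cinv c) >].

Lemma smooth_funP (f : M -> R) : reflect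
  (forall c : chart R n M, atlas c -> smooth_on (ccod c) (f \o cinv c))
  (f \in smooth_fun).
Proof. exact: asboolP. Qed.

Lemma smooth_fun_subring : subring_closed smooth_fun.
Proof.
split=> [|f h /smooth_funP sf /smooth_funP sh
         |f h /smooth_funP sf /smooth_funP sh].
- by apply/smooth_funP => c _ k; apply: Ck_cst; exact: ccod_open.
- by apply/smooth_funP => c Ac k; apply: CkB => //;
    [exact: ccod_open|exact: sf|exact: sh].
- by apply/smooth_funP => c Ac k; apply: CkM => //;
    [exact: ccod_open|exact: sf|exact: sh].
Qed.

HB.instance Definition _ :=
  GRing.isSubringClosed.Build (M -> R) smooth_fun smooth_fun_subring.

Record Cinf := MkCinf { Cinf_fun :> M -> R; _ : Cinf_fun \in smooth_fun }.

HB.instance Definition _ := [isSub for Cinf_fun].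
HB.instance Definition _ := [Choice of Cinf by <:].
HB.instance Definition _ :=
  GRing.SubChoice_isSubComPzRing.Build _ _ Cinf (subringClosedP _).

Lemma cst_smooth (a : R) : (cst a : M -> R) \in smooth_fun.
Proof. by apply/smooth_funP => c _ k; apply: Ck_cst; exact: ccod_open. Qed.

Definition Cinf_cst (a : R) : Cinf := MkCinf (cst_smooth a).

End SmoothFunctions.
Arguments smooth_fun {R n} M _.

Notation "a %:cst" := (Cinf_cst _ a)
  (at level 1, format "a %:cst") : ring_scope.

Section VectorFields.
Variables (R : realType) (n : nat) (M : manifoldType R n).
Notation F := (Cinf M).

(* Vector fields are the R-linear derivations of the algebra of smooth
   functions. *)
Definition derivation : {pred F -> F^o} :=
  fun D => `[<
    (forall (a : R) (f h : F), D (a%:cst * f + h) = a%:cst * D f + D h) /\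
    (forall f h : F, D (f * h) = D f * h + f * D h) >].

Lemma derivationP (D : F -> F^o) : reflect
  ((forall (a : R) (f h : F), D (a%:cst * f + h) = a%:cst * D f + D h) /\
   (forall f h : F, D (f * h) = D f * h + f * D h))
  (D \in derivation).
Proof. exact: asboolP. Qed.

Lemma derivation_submod : GRing.submod_closed derivation.
Proof.
split=> [|u D E /derivationP[Dl DM] /derivationP[El EM]].
  by apply/derivationP; split=> *; rewrite /= ?mulr0 ?mul0r ?addr0.
apply/derivationP; split=> [a f h|f h]; rewrite !fctE /=.
  by rewrite Dl El /GRing.scale /=; ring.
by rewrite DM EM /GRing.scale /=; ring.
Qed.

HB.instance Definition _ :=
  GRing.isSubmodClosed.Build F (F -> F^o) derivation derivation_submod.

Record vfield := VField { vf_fun :> F -> F^o; _ : vf_fun \in derivation }.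

HB.instance Definition _ := [isSub for vf_fun].
HB.instance Definition _ := [Choice of vfield by <:].
HB.instance Definition _ := [SubChoice_isSubLmodule of vfield by <:].

Lemma vf_lin (X : vfield) (a : R) (f h : F) :
  X (a%:cst * f + h) = a%:cst * X f + X h.
Proof. by have /derivationP[] := valP X. Qed.

Lemma vfM (X : vfield) (f h : F) : X (f * h) = X f * h + f * X h.
Proof. by have /derivationP[] := valP X. Qed.

Lemma vfD (X : vfield) (f h : F) : X (f + h) = X f + X h.
Proof.
by have := vf_lin X 1 f h; rewrite (_ : 1%:cst = 1) ?mul1r//; exact: val_inj.
Qed.

Lemma vbracket_subproof (X Y : vfield) :
  (fun f : F => X (Y f) - Y (X f) : F^o) \in derivation.
Proof.
apply/derivationP; split=> [a f h|f h] /=; first by rewrite !vf_lin; ring.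
by rewrite !(vfM, vfD); ring.
Qed.

Definition vbracket (X Y : vfield) : vfield := VField (vbracket_subproof X Y).

End VectorFields.
Arguments derivation {R n} M _.

Section LeftTranslation.
Variables (R : realType) (n : nat) (G : lieGroupType R n).
Notation F := (Cinf G).

Lemma mulg_chart_open (c1 c2 d : chart R n G) :
  open [set p | [/\ ccod c1 p.1, ccod c2 p.2 &
                  cdom d (cinv c1 p.1 * cinv c2 p.2)%g]].
Proof.
rewrite openE => -[u w] [/= cu cw duw].
have cm : {for (u, w), continuous (fun p : 'rV[R]_n * 'rV[R]_n =>
    cinv c1 p.1 * cinv c2 p.2)%g}.
  apply: (@continuous_comp _ _ _ (fun p : 'rV[R]_n * 'rV[R]_n =>
    (cinv c1 p.1, cinv c2 p.2)) (fun q : G * G => q.1 * q.2)%g).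
    apply: cvg_pair; apply: (@continuous_comp _ _ _ _ (cinv _)).
    - exact: cvg_fst.
    - exact: cinv_cont.
    - exact: cvg_snd.
    - exact: cinv_cont.
  exact: mulg_continuous.
have n1 : nbhs (u, w) [set p : 'rV[R]_n * 'rV[R]_n | ccod c1 p.1].
  by apply: cvg_fst; apply: open_nbhs_nbhs; split => //; exact: ccod_open.
have n2 : nbhs (u, w) [set p : 'rV[R]_n * 'rV[R]_n | ccod c2 p.2].
  by apply: cvg_snd; apply: open_nbhs_nbhs; split => //; exact: ccod_open.
have n3 : nbhs (u, w) [set p : 'rV[R]_n * 'rV[R]_n |
    cdom d (cinv c1 p.1 * cinv c2 p.2)%g].
  by apply: cm; apply: open_nbhs_nbhs; split => //; exact: cdom_open.
by near=> p; split; near: p.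
Unshelve. all: by end_near. Qed.

Lemma lcomp_subproof (a : G) (f : F) :
  (fun x => f (a * x)%g) \in smooth_fun G.
Proof.
have /smooth_funP sf := valP f.
apply/smooth_funP => c Ac k; apply: Ck_local => w cw.
have [c1 Ac1 c1a] := atlas_cover a.
have [d Ad dax] := atlas_cover (a * cinv c w)%g.
have oP := @mulg_chart_open c1 c d.
have Cm := mulg_smooth _ _ _ Ac1 Ac Ad.
exists [set y | [/\ ccod c1 (cmap c1 a), ccod c y &
                  cdom d (cinv c1 (cmap c1 a) * cinv c y)%g]].
have oS := open_slice (cmap c1 a) oP.
split=> //; first by split=> //; [exact: cmap_sub|rewrite cmapK].
apply: (eq_Ck oS _ (Ck_comp oS _ (Ck_slice (cmap c1 a) oP (Cm k)) (sf _ Ad k))).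
- by move=> y [_ cy dy] /=; rewrite cmapK// cmapK// -{1}(cmapK c1a).
- by move=> y [_ cy dy] /=; exact: cmap_sub.
Qed.

(* f \o L_a, for L_a the left translation by a. *)
Definition lcomp (a : G) (f : F) : F := MkCinf (lcomp_subproof a f).

Lemma lpush_subproof (a : G) (X : vfield G) :
  (fun f : F => lcomp a^-1%g (X (lcomp a f)) : F^o) \in derivation G.
Proof.
have E (f h : F) : f =1 h -> f = h by move=> fh; apply: val_inj; exact: funext.
apply/derivationP; split=> [r f h|f h].
  have -> : lcomp a (r%:cst * f + h) = r%:cst * lcomp a f + lcomp a h.
    exact: E.
  by rewrite vf_lin; exact: E.
have -> : lcomp a (f * h) = lcomp a f * lcomp a h by exact: E.
by rewrite vfM; apply: E => x; rewrite /= !fctE /= mulVKg.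
Qed.

(* The differential of the left translation by a, acting on vector fields. *)
Definition lpush (a : G) (X : vfield G) : vfield G :=
  VField (lpush_subproof a X).

End LeftTranslation.

(* Tensor fields are given as maps on vector fields that are linear over the
   ring of smooth functions. *)
Section Tensors.
Variables (R : realType) (n : nat) (M : manifoldType R n).
Notation F := (Cinf M).
Notation V := (vfield M).

Definition tensor02 (w : V -> V -> F) : Prop :=
  (forall (f : F) (X Y Z : V), w (f *: X + Y) Z = f * w X Z + w Y Z) /\
  (forall (f : F) (X Y Z : V), w Z (f *: X + Y) = f * w Z X + w Z Y).

Definition tensor11 (A : V -> V) : Prop :=
  forall (f : F) (X Y : V), A (f *: X + Y) = f *: A X + A Y.

Definition product_structure (J : V -> V) : Prop :=
  tensor11 J /\ (forall X, J (J X) = X).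

Definition connection (nabla : V -> V -> V) : Prop :=
  [/\ (forall (f : F) (X Y Z : V),
         nabla (f *: X + Y) Z = f *: nabla X Z + nabla Y Z),
      (forall X Y Z : V, nabla X (Y + Z) = nabla X Y + nabla X Z) &
      (forall (f : F) (X Y : V), nabla X (f *: Y) = X f *: Y + f *: nabla X Y)].

Definition levi_civita (g : V -> V -> F) (nabla : V -> V -> V) : Prop :=
  [/\ connection nabla,
      (forall X Y : V, nabla X Y - nabla Y X = vbracket X Y) &
      (forall X Y Z : V, X (g Y Z) = g (nabla X Y) Z + g Y (nabla X Z))].

(* cov11 nabla A X Y = (nabla_X A) Y *)
Definition cov11 (nabla : V -> V -> V) (A : V -> V) (X Y : V) : V :=
  nabla X (A Y) - A (nabla X Y).

(* cov02 nabla w X Y Z = (nabla_X w)(Y, Z) *)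
Definition cov02 (nabla : V -> V -> V) (w : V -> V -> F) (X Y Z : V) : F :=
  X (w Y Z) - w (nabla X Y) Z - w Y (nabla X Z).

Definition canonical_connection (nabla : V -> V -> V) (J : V -> V)
    (X Y : V) : V :=
  nabla X Y - (2^-1)%:cst *: cov11 nabla J X (J Y).

Definition curvature (nabla : V -> V -> V) (X Y Z : V) : V :=
  nabla X (nabla Y Z) - nabla Y (nabla X Z) - nabla (vbracket X Y) Z.

Definition codazzi (nabla : V -> V -> V) (w : V -> V -> F) : Prop :=
  forall X Y Z : V, cov02 nabla w X Y Z - cov02 nabla w Y X Z = 0.

End Tensors.

Section Lorentz3.
Variables (R : realType) (M : manifoldType R 3).
Notation F := (Cinf M).
Notation V := (vfield M).

(* M being three-dimensional, orthonormal triples at p are bases of the tangent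
   space at p; X f p = 0 for all f expresses that X vanishes at p. *)
Definition lorentzian_metric (g : V -> V -> F) : Prop :=
  [/\ tensor02 g,
      (forall X Y : V, g X Y = g Y X),
      (forall (p : M) (X : V), (forall Y : V, g X Y p = 0) ->
         forall f : F, X f p = 0) &
      (forall p : M, exists E1 E2 E3 : V,
         [/\ g E1 E1 p = 1, g E2 E2 p = 1, g E3 E3 p = -1 &
             [/\ g E1 E2 p = 0, g E1 E3 p = 0 & g E2 E3 p = 0]])].

Definition pseudo_orthonormal (g : V -> V -> F) (e1 e2 e3 : V) : Prop :=
  [/\ g e1 e1 = 1, g e2 e2 = 1, g e3 e3 = -1 &
      [/\ g e1 e2 = 0, g e1 e3 = 0 & g e2 e3 = 0]].

Definition ricci (g : V -> V -> F) (nabla : V -> V -> V) (e1 e2 e3 : V)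
    (X Y : V) : F :=
  - g (curvature nabla X e1 Y) e1 - g (curvature nabla X e2 Y) e2
  + g (curvature nabla X e3 Y) e3.

Definition sym_ricci (g : V -> V -> F) (nabla : V -> V -> V) (e1 e2 e3 : V)
    (X Y : V) : F :=
  (2^-1)%:cst * (ricci g nabla e1 e2 e3 X Y + ricci g nabla e1 e2 e3 Y X).

End Lorentz3.

Section LeftInvariance.
Variables (R : realType) (n : nat) (G : lieGroupType R n).

Definition left_invariant (X : vfield G) : Prop := forall a : G, lpush a X = X.

Definition left_invariant_metric (g : vfield G -> vfield G -> Cinf G) : Prop :=
  forall (a : G) X Y, lcomp a (g (lpush a X) (lpush a Y)) = g X Y.

(* Basis, over the reals, of the Lie algebra of left-invariant fields. *)
Definition lie_basis3 (e1 e2 e3 : vfield G) : Prop :=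
  [/\ left_invariant e1, left_invariant e2, left_invariant e3 &
      forall X, left_invariant X -> exists! c : R * R * R,
        X = c.1.1%:cst *: e1 + c.1.2%:cst *: e2 + c.2%:cst *: e3].

End LeftInvariance.

(* Main.v *)
Require Import Defs.
From mathcomp Require Import all_boot all_order all_algebra.
From mathcomp Require Import all_classical all_reals all_analysis.
From mathcomp Require Import ring lra.

Local Open Scope classical_set_scope.
Local Open Scope ring_scope.

Import Order.TTheory GRing.Theory Num.Theory.

(** The canonical connection D = (nabla + J nabla J) / 2 is the Levi-Civita
connection projected onto the two eigenbundles of J, spanned by e1, e2 and by
e3.  Metricity leaves only an infinitesimal rotation in the plane of e1 and e2:

  D_X e1 = a(X) e2,   D_X e2 = - a(X) e1,   D_X e3 = 0,

where a(X) = g(nabla_X e1, e2).  A rotation algebra of rank one is abelian, so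
the curvature of D is the 2-form da times the rotation generator, and the Ricci
tensor can be read off da on the frame: rho(X, e1) = - da(X, e2),
rho(X, e2) = da(X, e1) and rho(X, e3) = 0 ([ricci_e1], [ricci_e2],
[ricci_e3]).  Koszul's formula and the brackets give a(e1) = - alpha,
a(e2) = 0, a(e3) = beta / 2, whence for the symmetrized Ricci tensor w the
values w(e1, e2) = 0 and w(e2, e3) = alpha^2 / 2, all w(ei, ej) being constant.
Therefore

  (D_e1 w)(e3, e1) - (D_e3 w)(e1, e1)
    = - w(e3, D_e1 e1) + 2 w(D_e3 e1, e1) = alpha^3 / 2,

which is nonzero.

Projecting onto the eigenbundles requires expanding nabla_X e_i in the frame.
The frame is given as a basis of the left-invariant fields only, so the point is
that nabla_X Y is left-invariant whenever X and Y are: pulling nabla back by the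
left translation by a group element, an isometry of g, again gives a Levi-Civita
connection, and there is only one ([left_invariant_levi_civita]). *)

(** * Smooth functions and vector fields *)

Section SmoothAlgebra.
Context {R : realType} {n : nat} {M : manifoldType R n}.
Implicit Types (f h : Cinf M) (X Y Z : vfield M).

Lemma Cinf_ext f h : (forall x, f x = h x) -> f = h.
Proof. by move=> fh; apply: val_inj; exact: funext. Qed.

Lemma Cinf_DE f h x : (f + h) x = f x + h x. Proof. by []. Qed.
Lemma Cinf_NE f x : (- f) x = - f x. Proof. by []. Qed.
Lemma Cinf_ME f h x : (f * h) x = f x * h x. Proof. by []. Qed.
Lemma Cinf_0E x : (0 : Cinf M) x = 0. Proof. by []. Qed.
Lemma Cinf_1E x : (1 : Cinf M) x = 1. Proof. by []. Qed.
Lemma Cinf_cstE (r : R) x : (r%:cst : Cinf M) x = r. Proof. by []. Qed.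
Definition CinfE := (Cinf_DE, Cinf_NE, Cinf_ME, Cinf_0E, Cinf_1E, Cinf_cstE).

(** Koszul's formula determines twice a function; this removes the factor. *)
Lemma Cinf_half f h : f + f = h + h -> f = h.
Proof.
move=> E; apply: Cinf_ext => x.
by move: (congr1 (fun k : Cinf M => k x) E); rewrite !CinfE; lra.
Qed.

Lemma half_cstD : (2^-1)%:cst + (2^-1)%:cst = 1 :> Cinf M.
Proof. by apply: Cinf_ext => x; rewrite !CinfE; lra. Qed.

Lemma vf_ext X Y : (forall f, X f = Y f) -> X = Y.
Proof. by move=> XY; apply: val_inj; exact: funext. Qed.

Lemma vf_DE X Y f : (X + Y) f = X f + Y f. Proof. by []. Qed.
Lemma vf_NE X f : (- X) f = - X f. Proof. by []. Qed.
Lemma vf_0E f : (0 : vfield M) f = 0. Proof. by []. Qed.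
Lemma vf_ZE h X f : (h *: X) f = h * X f. Proof. by []. Qed.
Lemma vbracketE X Y f : vbracket X Y f = X (Y f) - Y (X f). Proof. by []. Qed.
Definition vfE := (vf_DE, vf_NE, vf_0E, vf_ZE, vbracketE).

Lemma vf0 X : X 0 = 0.
Proof. by apply: (addrI (X 0)); rewrite -vfD !addr0. Qed.

Lemma vfN X f : X (- f) = - X f.
Proof. by apply/eqP; rewrite -addr_eq0 -vfD addNr vf0. Qed.

Lemma vf1 X : X 1 = 0.
Proof.
by apply: (addrI (X 1)); have := vfM X 1 1; rewrite !mulr1 mul1r addr0 => <-.
Qed.

Lemma vf_cst X (a : R) : X a%:cst = 0.
Proof.
have := vf_lin X a 1 0.
by rewrite vf1 vf0 mulr1 mulr0 !addr0.
Qed.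

Lemma vbracketC X Y : vbracket Y X = - vbracket X Y.
Proof. by apply: vf_ext => f; rewrite !vfE opprB. Qed.

Lemma vbracketxx X : vbracket X X = 0.
Proof. by apply: vf_ext => f; rewrite !vfE subrr. Qed.

Lemma vbracketZl f X Y : vbracket (f *: X) Y = f *: vbracket X Y - Y f *: X.
Proof. by apply: vf_ext => h; rewrite !vfE vfM; ring. Qed.

End SmoothAlgebra.

(** * Tensors and connections *)

Section Connections.
Context {R : realType} {n : nat} {M : manifoldType R n}.
Implicit Types (f h : Cinf M) (X Y Z : vfield M).
Implicit Types (nabla : vfield M -> vfield M -> vfield M).
Implicit Types (J : vfield M -> vfield M).

Section Tensor02.
Context {w : vfield M -> vfield M -> Cinf M} (tw : tensor02 w).

Lemma tensor02Dl X Y Z : w (X + Y) Z = w X Z + w Y Z.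
Proof. by have := tw.1 1 X Y Z; rewrite scale1r mul1r. Qed.
Lemma tensor02Dr X Y Z : w Z (X + Y) = w Z X + w Z Y.
Proof. by have := tw.2 1 X Y Z; rewrite scale1r mul1r. Qed.
Lemma tensor020l Z : w 0 Z = 0.
Proof. by apply: (addrI (w 0 Z)); rewrite -tensor02Dl !addr0. Qed.
Lemma tensor020r Z : w Z 0 = 0.
Proof. by apply: (addrI (w Z 0)); rewrite -tensor02Dr !addr0. Qed.
Lemma tensor02Zl f X Z : w (f *: X) Z = f * w X Z.
Proof. by have := tw.1 f X 0 Z; rewrite !addr0 tensor020l addr0. Qed.
Lemma tensor02Zr f X Z : w Z (f *: X) = f * w Z X.
Proof. by have := tw.2 f X 0 Z; rewrite !addr0 tensor020r addr0. Qed.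
Lemma tensor02Nl X Z : w (- X) Z = - w X Z.
Proof. by rewrite -scaleN1r tensor02Zl mulN1r. Qed.
Lemma tensor02Nr X Z : w Z (- X) = - w Z X.
Proof. by rewrite -scaleN1r tensor02Zr mulN1r. Qed.

Definition tensor02E := (tensor02Dl, tensor02Dr, tensor02Zl, tensor02Zr,
  tensor02Nl, tensor02Nr, tensor020l, tensor020r).
End Tensor02.

Section Tensor11.
Context {A : vfield M -> vfield M} (tA : tensor11 A).

Lemma tensor11D X Y : A (X + Y) = A X + A Y.
Proof. by have := tA 1 X Y; rewrite !scale1r. Qed.
Lemma tensor11Z f X : A (f *: X) = f *: A X.
Proof.
have A0 : A 0 = 0 by apply: (addrI (A 0)); rewrite -tensor11D !addr0.
by have := tA f X 0; rewrite A0 !addr0.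
Qed.
Lemma tensor11N X : A (- X) = - A X.
Proof. by rewrite -scaleN1r tensor11Z scaleN1r. Qed.
End Tensor11.

Section Connection.
Context {nabla : vfield M -> vfield M -> vfield M} (cn : connection nabla).

Lemma connectionDl X Y Z : nabla (X + Y) Z = nabla X Z + nabla Y Z.
Proof. by have [H _ _] := cn; have := H 1 X Y Z; rewrite !scale1r. Qed.
Lemma connectionDr X Y Z : nabla X (Y + Z) = nabla X Y + nabla X Z.
Proof. by have [_ H _] := cn. Qed.
Lemma connectionZl f X Z : nabla (f *: X) Z = f *: nabla X Z.
Proof.
have n0 : nabla 0 Z = 0.
  by apply: (addrI (nabla 0 Z)); rewrite -connectionDl !addr0.
by have [H _ _] := cn; have := H f X 0 Z; rewrite n0 !addr0.
Qed.
Lemma connectionNl X Z : nabla (- X) Z = - nabla X Z.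
Proof. by rewrite -scaleN1r connectionZl scaleN1r. Qed.
Lemma connectionZr f X Y : nabla X (f *: Y) = X f *: Y + f *: nabla X Y.
Proof. by have [_ _ H] := cn. Qed.
Lemma connectionNr X Y : nabla X (- Y) = - nabla X Y.
Proof.
by rewrite -scaleN1r connectionZr vfN vf1 oppr0 scale0r add0r scaleN1r.
Qed.
Lemma connection0r X : nabla X 0 = 0.
Proof. by apply: (addrI (nabla X 0)); rewrite -connectionDr !addr0. Qed.

(** The derivative of f coming from the product rule for Y cancels the one in
[f X, Y] = f [X, Y] - Y(f) X. *)
Lemma curvatureZl f X Y Z :
  curvature nabla (f *: X) Y Z = f *: curvature nabla X Y Z.
Proof.
rewrite /curvature vbracketZl connectionDl connectionNl !connectionZl.
rewrite connectionZr.
by apply: vf_ext => h; rewrite !vfE; ring.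
Qed.

(** The second derivatives of f assemble into X(Y f) - Y(X f) - [X, Y] f, and
the first-order terms cancel in pairs. *)
Lemma curvatureZr f X Y Z :
  curvature nabla X Y (f *: Z) = f *: curvature nabla X Y Z.
Proof.
rewrite /curvature !(connectionZr, connectionDr).
by apply: vf_ext => h; rewrite !vfE; ring.
Qed.
End Connection.

Section LeviCivita.
Context {g : vfield M -> vfield M -> Cinf M}.
Hypotheses (tg : tensor02 g) (gC : forall X Y, g X Y = g Y X).

(** Koszul's formula, with the factor 2 on the left written as a sum: using
metricity for the three derivatives and the absence of torsion for the three
brackets, everything cancels except two copies of g(nabla_X Y, Z). *)
Lemma koszul nabla X Y Z : levi_civita g nabla ->
  g (nabla X Y) Z + g (nabla X Y) Z =
    X (g Y Z) + Y (g X Z) - Z (g X Y)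
    + g (vbracket X Y) Z - g (vbracket Y Z) X + g (vbracket Z X) Y.
Proof.
move=> [cn tors metric].
rewrite -!tors !metric !(tensor02E tg).
rewrite (gC Y (nabla X Z)) (gC X (nabla Y Z)) (gC X (nabla Z Y)).
ring.
Qed.

(** Koszul's formula determines g(nabla_X Y, Z) for every Z, hence nabla_X Y
by nondegeneracy of g. *)
Lemma levi_civita_unique {nabla nabla'} :
  (forall p X, (forall Y, g X Y p = 0) -> forall f, X f p = 0) ->
  levi_civita g nabla -> levi_civita g nabla' ->
  forall X Y, nabla X Y = nabla' X Y.
Proof.
move=> nondeg lc lc' X Y; apply/eqP; rewrite -subr_eq0; apply/eqP.
apply: vf_ext => f; apply: Cinf_ext => p; apply: nondeg => Z.
rewrite tensor02Dl // tensor02Nl //.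
have -> : g (nabla X Y) Z = g (nabla' X Y) Z.
  by apply: Cinf_half; rewrite !koszul.
by rewrite subrr.
Qed.
End LeviCivita.

(** Since J is an involution, the canonical connection is the average of nabla
and its conjugate by J: it is the part of nabla that preserves the two
eigenbundles of J. *)
Lemma canonical_connectionE nabla J X Y :
  connection nabla -> product_structure J ->
  canonical_connection nabla J X Y =
  (2^-1)%:cst *: (nabla X Y + J (nabla X (J Y))).
Proof.
move=> cn [tJ JJ]; rewrite /canonical_connection /cov11 JJ.
rewrite -[X in X - _]scale1r -half_cstD.
by apply: vf_ext => f; rewrite !vfE; ring.
Qed.

Lemma canonical_connection_connection nabla J :
  connection nabla -> product_structure J ->
  connection (canonical_connection nabla J).
Proof.
move=> cn Jps; have [tJ JJ] := Jps.
split=> [f X Y Z|X Y Z|f X Y]; rewrite !canonical_connectionE //.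
- rewrite !(connectionDl cn, connectionZl cn) tJ.
  by apply: vf_ext => h; rewrite !vfE; ring.
- rewrite (tensor11D tJ) !(connectionDr cn) (tensor11D tJ).
  by apply: vf_ext => h; rewrite !vfE; ring.
- rewrite (tensor11Z tJ) !(connectionZr cn) tJ (tensor11Z tJ) JJ.
  rewrite -[X f *: Y in RHS]scale1r -half_cstD.
  by apply: vf_ext => h; rewrite !vfE; ring.
Qed.

End Connections.

Section SymRicci.
Context {R : realType} {M : manifoldType R 3}.
Context {g : vfield M -> vfield M -> Cinf M}.
Context {nabla : vfield M -> vfield M -> vfield M}.
Hypotheses (tg : tensor02 g) (cn : connection nabla).

(** By symmetry, linearity in one argument is enough to evaluate the symmetrized
Ricci tensor on the multiples of frame fields. *)
Lemma sym_ricciC e1 e2 e3 X Y :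
  sym_ricci g nabla e1 e2 e3 X Y = sym_ricci g nabla e1 e2 e3 Y X.
Proof. by rewrite /sym_ricci addrC. Qed.

Lemma sym_ricciZl e1 e2 e3 f X Y :
  sym_ricci g nabla e1 e2 e3 (f *: X) Y = f * sym_ricci g nabla e1 e2 e3 X Y.
Proof.
rewrite /sym_ricci /ricci !(curvatureZl cn, curvatureZr cn).
by rewrite !(tensor02Zl tg); ring.
Qed.

End SymRicci.

(** * Left translations *)

Section Translations.
Context {R : realType} {n : nat} {G : lieGroupType R n}.
Implicit Types (a : G) (f h : Cinf G) (X Y Z : vfield G).

Lemma lcompD a f h : lcomp a (f + h) = lcomp a f + lcomp a h.
Proof. exact: Cinf_ext. Qed.
Lemma lcompN a f : lcomp a (- f) = - lcomp a f.
Proof. exact: Cinf_ext. Qed.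
Lemma lcompM a f h : lcomp a (f * h) = lcomp a f * lcomp a h.
Proof. exact: Cinf_ext. Qed.
Lemma lcompK a f : lcomp a^-1%g (lcomp a f) = f.
Proof. by apply: Cinf_ext => x /=; rewrite mulVKg. Qed.
Lemma lcompVK a f : lcomp a (lcomp a^-1%g f) = f.
Proof. by apply: Cinf_ext => x /=; rewrite mulKg. Qed.

Lemma lpushE a X f : lpush a X f = lcomp a^-1%g (X (lcomp a f)).
Proof. by []. Qed.
Lemma lcomp_lpush a X f : lcomp a (lpush a X f) = X (lcomp a f).
Proof. by rewrite lpushE lcompVK. Qed.
Lemma lpushK a X : lpush a^-1%g (lpush a X) = X.
Proof. by apply: vf_ext => f; rewrite !lpushE invgK lcompVK lcompVK. Qed.
Lemma lpushVK a X : lpush a (lpush a^-1%g X) = X.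
Proof. by apply: vf_ext => f; rewrite !lpushE invgK lcompK lcompK. Qed.

Lemma lpushD a X Y : lpush a (X + Y) = lpush a X + lpush a Y.
Proof. by apply: vf_ext => f; rewrite !(lpushE, vfE) lcompD. Qed.
Lemma lpushN a X : lpush a (- X) = - lpush a X.
Proof. by apply: vf_ext => f; rewrite !(lpushE, vfE) lcompN. Qed.
Lemma lpushZ a f X : lpush a (f *: X) = lcomp a^-1%g f *: lpush a X.
Proof. by apply: vf_ext => h; rewrite !(lpushE, vfE) lcompM. Qed.
Lemma lpush_vbracket a X Y :
  lpush a (vbracket X Y) = vbracket (lpush a X) (lpush a Y).
Proof.
apply: vf_ext => f.
by rewrite !(lpushE, vbracketE) lcompD lcompN !lcompVK.
Qed.

(** The pullback of nabla by the left translation by a: since translations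
respect brackets and preserve g, each defining property of the Levi-Civita
connection is transported. *)
Lemma levi_civita_lpush g nabla a :
  left_invariant_metric g -> levi_civita g nabla ->
  levi_civita g (fun X Y => lpush a^-1%g (nabla (lpush a X) (lpush a Y))).
Proof.
move=> ginv [cn tors metric]; split; first split.
- move=> f X Y Z; rewrite lpushD lpushZ (connectionDl cn) (connectionZl cn).
  by rewrite lpushD lpushZ invgK lcompVK.
- by move=> X Y Z; rewrite lpushD (connectionDr cn) lpushD.
- move=> f X Y; rewrite lpushZ (connectionZr cn) lpushD !lpushZ !invgK.
  by rewrite lcomp_lpush !lcompVK lpushK.
- move=> X Y.
  by rewrite -lpushN -lpushD tors -lpush_vbracket lpushK.
- move=> X Y Z; rewrite -[g Y Z](ginv a) -lcomp_lpush metric lcompD.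
  by rewrite -[in RHS](ginv a) -[g Y _ in RHS](ginv a) !lpushVK.
Qed.

(** By uniqueness, every left translation preserves nabla, and a translation
fixing X and Y then fixes nabla_X Y. *)
Lemma left_invariant_levi_civita g nabla X Y :
  tensor02 g -> (forall X Y, g X Y = g Y X) ->
  (forall p X, (forall Y, g X Y p = 0) -> forall f, X f p = 0) ->
  left_invariant_metric g -> levi_civita g nabla ->
  left_invariant X -> left_invariant Y -> left_invariant (nabla X Y).
Proof.
move=> tg gC nondeg ginv lc iX iY a.
have := levi_civita_unique tg gC nondeg lc
  (levi_civita_lpush _ _ a^-1%g ginv lc) X Y.
by rewrite iX iY invgK => /esym.
Qed.

Lemma left_invariant_vbracket X Y :
  left_invariant X -> left_invariant Y -> left_invariant (vbracket X Y).
Proof. by move=> iX iY a; rewrite lpush_vbracket iX iY. Qed.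

End Translations.

(** * Curvature of a connection rotating a plane of the frame *)

Section Frame.
Context {R : realType} {G : lieGroupType R 3}.
Context {g : vfield G -> vfield G -> Cinf G} {e1 e2 e3 : vfield G}.
Implicit Types (X Y Z W : vfield G).
Hypotheses (tg : tensor02 g) (gC : forall X Y, g X Y = g Y X).
Hypotheses (e_basis : lie_basis3 e1 e2 e3).
Hypotheses (e_on : pseudo_orthonormal g e1 e2 e3).

Lemma frame_products :
  (g e1 e1 = 1) * (g e2 e2 = 1) * (g e3 e3 = -1) *
  (g e1 e2 = 0) * (g e1 e3 = 0) * (g e2 e3 = 0) *
  (g e2 e1 = 0) * (g e3 e1 = 0) * (g e3 e2 = 0).
Proof.
have [g11 g22 g33 [g12 g13 g23]] := e_on.
by rewrite (gC e2 e1) (gC e3 e1) (gC e3 e2).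
Qed.

(** The constant coefficients given by [lie_basis3] are recovered from g; the
sign of the last term is that of g(e3, e3) = -1. *)
Lemma frame_expansion W : left_invariant W ->
  W = g W e1 *: e1 + g W e2 *: e2 - g W e3 *: e3.
Proof.
have [_ _ _ span] := e_basis => /span[[[c1 c2] c3] /= [-> _]].
rewrite !(tensor02E tg) !frame_products.
by apply: vf_ext => f; rewrite !vfE; ring.
Qed.

(** The exterior derivative of the 1-form a. *)
Definition ext_derivative (a : vfield G -> Cinf G) X Y : Cinf G :=
  X (a Y) - Y (a X) - a (vbracket X Y).

Section Rotation.
Context {nabla : vfield G -> vfield G -> vfield G} {a : vfield G -> Cinf G}.
Hypothesis (cn : connection nabla).
Hypotheses
  (nabla1 : forall X, left_invariant X -> nabla X e1 = a X *: e2)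
  (nabla2 : forall X, left_invariant X -> nabla X e2 = - (a X *: e1))
  (nabla3 : forall X, left_invariant X -> nabla X e3 = 0).

(** The quadratic terms in a produced by iterating nabla cancel, because
rotations of a plane commute. *)
Lemma curvature_e1 X Y : left_invariant X -> left_invariant Y ->
  curvature nabla X Y e1 = ext_derivative a X Y *: e2.
Proof.
move=> iX iY; have iXY := left_invariant_vbracket _ _ iX iY.
rewrite /curvature !nabla1 // !(connectionZr cn) !nabla2 //.
by apply: vf_ext => f; rewrite /ext_derivative !vfE; ring.
Qed.

Lemma curvature_e2 X Y : left_invariant X -> left_invariant Y ->
  curvature nabla X Y e2 = - (ext_derivative a X Y *: e1).
Proof.
move=> iX iY; have iXY := left_invariant_vbracket _ _ iX iY.
rewrite /curvature !nabla2 // !(connectionNr cn) !(connectionZr cn) !nabla1 //.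
by apply: vf_ext => f; rewrite /ext_derivative !vfE; ring.
Qed.

Lemma curvature_e3 X Y : left_invariant X -> left_invariant Y ->
  curvature nabla X Y e3 = 0.
Proof.
move=> iX iY; have iXY := left_invariant_vbracket _ _ iX iY.
by rewrite /curvature !nabla3 // !(connection0r cn) !subr0.
Qed.

Lemma ricci_e1 X : left_invariant X ->
  ricci g nabla e1 e2 e3 X e1 = - ext_derivative a X e2.
Proof.
have [inv1 inv2 inv3 _] := e_basis => iX.
rewrite /ricci !curvature_e1 // !(tensor02E tg) !frame_products.
by ring.
Qed.

Lemma ricci_e2 X : left_invariant X ->
  ricci g nabla e1 e2 e3 X e2 = ext_derivative a X e1.
Proof.
have [inv1 inv2 inv3 _] := e_basis => iX.
rewrite /ricci !curvature_e2 // !(tensor02E tg) !frame_products.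
by ring.
Qed.

Lemma ricci_e3 X : left_invariant X -> ricci g nabla e1 e2 e3 X e3 = 0.
Proof.
have [inv1 inv2 inv3 _] := e_basis => iX.
rewrite /ricci !curvature_e3 // !(tensor02E tg).
by ring.
Qed.

End Rotation.

(** * The canonical connection in the frame *)

Section Canonical.
Context {nabla : vfield G -> vfield G -> vfield G} {J : vfield G -> vfield G}.
Hypotheses (lc : levi_civita g nabla)
  (nondeg : forall p X, (forall Y, g X Y p = 0) -> forall f, X f p = 0)
  (g_inv : left_invariant_metric g) (J_ps : product_structure J)
  (Je1 : J e1 = e1) (Je2 : J e2 = e2) (Je3 : J e3 = - e3).

(** The e1 component of nabla_X e1 vanishes because g(e1, e1) is constant, and
the e3 component is killed by the average over J. *)
Lemma canonical_e1 X : left_invariant X ->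
  canonical_connection nabla J X e1 = g (nabla X e1) e2 *: e2.
Proof.
have [inv1 _ _ _] := e_basis; have [cn _ metric] := lc; have [tJ _] := J_ps.
move=> iX; rewrite canonical_connectionE // Je1.
have iW := left_invariant_levi_civita _ _ _ _ tg gC nondeg g_inv lc iX inv1.
have W1 : g (nabla X e1) e1 = 0.
  apply: Cinf_half; have := metric X e1 e1.
  by rewrite (gC e1 (nabla X e1)) frame_products vf1 addr0.
rewrite {1 2}(frame_expansion _ iW) W1.
rewrite !(tensor11D tJ, tensor11N tJ, tensor11Z tJ) Je1 Je2 Je3.
rewrite -[RHS]scale1r -half_cstD.
by apply: vf_ext => f; rewrite !vfE; ring.
Qed.

(** The coefficient is opposite to that of [canonical_e1]: this is metricity
applied to the constant g(e1, e2). *)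
Lemma canonical_e2 X : left_invariant X ->
  canonical_connection nabla J X e2 = - (g (nabla X e1) e2 *: e1).
Proof.
have [inv1 inv2 _ _] := e_basis; have [cn _ metric] := lc.
have [tJ _] := J_ps; move=> iX; rewrite canonical_connectionE // Je2.
have iW := left_invariant_levi_civita _ _ _ _ tg gC nondeg g_inv lc iX inv2.
have W2 : g (nabla X e2) e2 = 0.
  apply: Cinf_half; have := metric X e2 e2.
  by rewrite (gC e2 (nabla X e2)) frame_products vf1 addr0.
have W1 : g (nabla X e2) e1 = - g (nabla X e1) e2.
  apply/eqP; rewrite -addr_eq0 addrC (gC (nabla X e2)) -metric.
  by rewrite frame_products vf0.
rewrite {1 2}(frame_expansion _ iW) W1 W2.
rewrite !(tensor11D tJ, tensor11N tJ, tensor11Z tJ) Je1 Je2 Je3.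
rewrite -[RHS]scale1r -half_cstD.
by apply: vf_ext => f; rewrite !vfE; ring.
Qed.

(** Only the e3 component survives the average over J, and it vanishes because
g(e3, e3) is constant. *)
Lemma canonical_e3 X : left_invariant X ->
  canonical_connection nabla J X e3 = 0.
Proof.
have [_ _ inv3 _] := e_basis; have [cn _ metric] := lc; have [tJ _] := J_ps.
move=> iX; rewrite canonical_connectionE // Je3 (connectionNr cn).
have iW := left_invariant_levi_civita _ _ _ _ tg gC nondeg g_inv lc iX inv3.
have W3 : g (nabla X e3) e3 = 0.
  apply: Cinf_half; have := metric X e3 e3.
  by rewrite (gC e3 (nabla X e3)) frame_products vfN vf1 oppr0 addr0.
rewrite (frame_expansion _ iW) W3.
rewrite !(tensor11D tJ, tensor11N tJ, tensor11Z tJ) Je1 Je2 Je3.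
by apply: vf_ext => f; rewrite !vfE; ring.
Qed.

End Canonical.
End Frame.

(** * Failure of the Codazzi equation *)

Theorem theorem4p2 (R : realType) (alpha beta : R) (G : lieGroupType R 3)
    (g : vfield G -> vfield G -> Cinf G) (e1 e2 e3 : vfield G)
    (nablaL : vfield G -> vfield G -> vfield G) (J : vfield G -> vfield G)
    (alpha_neq0 : alpha != 0)
    (G_connected : connected [set: G]) (G_sc : simply_connected R G)
    (g_lorentzian : lorentzian_metric g) (g_inv : left_invariant_metric g)
    (e_basis : lie_basis3 e1 e2 e3) (e_on : pseudo_orthonormal g e1 e2 e3)
    (e12 : vbracket e1 e2 = alpha%:cst *: e1 - beta%:cst *: e3)
    (e13 : vbracket e1 e3 = - (alpha%:cst *: e1) - beta%:cst *: e2)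
    (e23 : vbracket e2 e3 =
             beta%:cst *: e1 + alpha%:cst *: e2 + alpha%:cst *: e3)
    (nablaL_lc : levi_civita g nablaL)
    (J_ps : product_structure J)
    (Je1 : J e1 = e1) (Je2 : J e2 = e2) (Je3 : J e3 = - e3) :
  ~ codazzi (canonical_connection nablaL J)
      (sym_ricci g (canonical_connection nablaL J) e1 e2 e3).
Proof.
have [tg gC nondeg _] := g_lorentzian.
have [inv1 inv2 inv3 _] := e_basis.
have [cnL _ _] := nablaL_lc.
have cn := canonical_connection_connection _ _ cnL J_ps.
have gE := frame_products gC e_on.
have D1 := canonical_e1 tg gC e_basis e_on nablaL_lc nondeg g_inv
  J_ps Je1 Je2 Je3.
have D2 := canonical_e2 tg gC e_basis e_on nablaL_lc nondeg g_inv
  J_ps Je1 Je2 Je3.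
have D3 := canonical_e3 tg gC e_basis e_on nablaL_lc nondeg g_inv
  J_ps Je1 Je2 Je3.
(* The connection form of the canonical connection, and Koszul's formula. *)
set a : vfield G -> Cinf G := fun X => g (nablaL X e1) e2.
have aK X : a X + a X = X (g e1 e2) + e1 (g X e2) - e2 (g X e1)
    + g (vbracket X e1) e2 - g (vbracket e1 e2) X + g (vbracket e2 X) e1.
  exact: (koszul tg gC _ _ _ _ nablaL_lc).
have aD X Y : a (X + Y) = a X + a Y.
  by rewrite /a (connectionDl cnL) (tensor02Dl tg).
have aZ f X : a (f *: X) = f * a X.
  by rewrite /a (connectionZl cnL) (tensor02Zl tg).
have aN X : a (- X) = - a X.
  by rewrite /a (connectionNl cnL) (tensor02Nl tg).
have a1 : a e1 = (- alpha)%:cst.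
  apply: Cinf_half; rewrite aK (vbracketC e1 e2) e12 vbracketxx.
  rewrite !(tensor02E tg) !gE vf0 vf1.
  by apply: Cinf_ext => x; rewrite !CinfE; ring.
have a2 : a e2 = 0.
  apply: Cinf_half; rewrite aK (vbracketC e1 e2) e12 vbracketxx.
  by rewrite !(tensor02E tg) !gE !vf0 vf1; ring.
have a3 : a e3 = (beta / 2)%:cst.
  apply: Cinf_half; rewrite aK (vbracketC e1 e3) e13 e12 e23.
  rewrite !(tensor02E tg) !gE !vf0.
  by apply: Cinf_ext => x; rewrite !CinfE; field.
(* The values of da on pairs of frame fields; they are constants since those
   of a are, so only the bracket term contributes. *)
have rc12 : ext_derivative a e1 e2 = (alpha ^+ 2 + beta ^+ 2 / 2)%:cst.
  rewrite /ext_derivative e12 !(aD, aN, aZ) a1 a2 a3 vf0 vf_cst.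
  by apply: Cinf_ext => x; rewrite !CinfE; field.
have rc13 : ext_derivative a e1 e3 = (- alpha ^+ 2)%:cst.
  rewrite /ext_derivative e13 !(aD, aN, aZ) a1 a2 a3 !vf_cst.
  by apply: Cinf_ext => x; rewrite !CinfE; field.
have rc23 : ext_derivative a e2 e3 = (alpha * beta / 2)%:cst.
  rewrite /ext_derivative e23 !(aD, aN, aZ) a1 a2 a3 vf0 vf_cst.
  by apply: Cinf_ext => x; rewrite !CinfE; field.
have rcC X Y : ext_derivative a Y X = - ext_derivative a X Y.
  by rewrite /ext_derivative (vbracketC X Y) aN; ring.
have rcxx X : ext_derivative a X X = 0.
  by rewrite /ext_derivative vbracketxx -(scale0r 0) aZ mul0r subrr subr0.
have rho1 := ricci_e1 tg gC e_basis e_on cn D1 D2.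
have rho2 := ricci_e2 tg gC e_basis e_on cn D1 D2.
have rho3 := ricci_e3 tg e_basis cn D3.
set D := canonical_connection nablaL J in cn D1 D2 D3 rho1 rho2 rho3 *.
set w := sym_ricci g D e1 e2 e3 => cod.
have w11 : w e1 e1 = (- (alpha ^+ 2 + beta ^+ 2 / 2))%:cst.
  rewrite /w /sym_ricci !rho1 // rc12.
  by apply: Cinf_ext => x; rewrite !CinfE; field.
have w12 : w e1 e2 = 0.
  by rewrite /w /sym_ricci rho1 // rho2 // !rcxx; ring.
have w13 : w e1 e3 = (alpha * beta / 4)%:cst.
  rewrite /w /sym_ricci rho1 // rho3 // rcC rc23.
  by apply: Cinf_ext => x; rewrite !CinfE; field.
have w23 : w e2 e3 = (alpha ^+ 2 / 2)%:cst.
  rewrite /w /sym_ricci rho2 // rho3 // rcC rc13.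
  by apply: Cinf_ext => x; rewrite !CinfE; field.
have wC X Y : w X Y = w Y X by exact: sym_ricciC.
have wZl f X Y : w (f *: X) Y = f * w X Y by exact: sym_ricciZl.
have w0l X : w 0 X = 0 by rewrite -(scale0r 0) wZl mul0r.
(* The only term of this instance that survives is - w(e3, D_e1 e1), equal to
   alpha w(e3, e2). *)
have := cod e1 e3 e1.
rewrite /cov02 D3 // !D1 // -!/(a _) a1 a3 (wC e3 e1) w13 w11 !vf_cst w0l.
rewrite (wC e3) (wC e1) !wZl (wC e2 e1) w12 w23.
move=> /(congr1 (fun f : Cinf G => f 1%g)); rewrite !CinfE => E.
have : alpha ^+ 3 = 0 by move: E; lra.
by move/eqP; rewrite expf_eq0 /= (negbTE alpha_neq0).
Qed.
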